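(* Let $\rho\in(0,1)$, let $\tilde w_1,\dots,\tilde w_J$ be measurable symmetric functions $[0,1]^2\to[0,1]$, $w_j=\rho\tilde w_j$, and let $w^\star=1-\prod_{j=1}^J(1-w_j)$ (the superposition model). Let $x_j=-\log(1-w_j)$ and $$\mathcal N=\Big\{w_\gamma=1-\exp\Big(-\gamma_0-\sum_{j=1}^J\gamma_jx_j\Big):\ \gamma_0\ge0,\ \gamma_j\ge0\Big\}.$$ Then for every $\rho\in(0,1)$ and every choice of $\tilde w_1,\dots,\tilde w_J$, $w^\star=w_{\gamma^\star}$ with $\gamma^\star=(0,1,\dots,1)$, so $\operatorname{dist}(w^\star,\mathcal N)=0$. Moreover, for $\gamma$ (with nonnegative coordinates) in a bounded set, as $\rho\to0$, $$w_\gamma=(1-e^{-\gamma_0})+e^{-\gamma_0}\sum_{j}\gamma_jw_j+O(\rho^2)$$ uniformly, so that $w_\gamma$ agrees up to second order in $\rho$ with an element of the cone $\mathcal K=\{c+\sum_j\gamma'_jw_j:c\in\mathbb R,\ \gamma'_j\ge0\}$.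
   Context: $\operatorname{dist}(w,\mathcal S)=\inf_{h\in\mathcal S}\|w-h\|$ with $\|\cdot\|$ the $L_2([0,1]^2)$ norm. *)

(* Defs.v *)
From HB Require Import structures.
From mathcomp Require Import all_boot all_order all_algebra.
From mathcomp Require Import all_classical all_reals all_analysis.
Import Order.TTheory GRing.Theory Num.Theory.
Import numFieldNormedType.Exports.

Set Implicit Arguments.
Unset Strict Implicit.
Unset Printing Implicit Defensive.

Local Open Scope classical_set_scope.
Local Open Scope ring_scope.

Definition unit_square (R : realType) : set (R * R) :=
  `[0, 1]%classic `*` `[0, 1]%classic.
Arguments unit_square : clear implicits.

(* Functions [0,1]^2 -> R are represented by total functions on R * R; only
   their values on [unit_square R] are constrained or used. *)
Definition graphon (R : realType) (w : R * R -> R) : Prop :=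
  [/\ measurable_fun (unit_square R) w,
      forall x y, unit_square R (x, y) -> w (x, y) = w (y, x)
    & forall p, unit_square R p -> 0 <= w p <= 1].

(* [f \_ D] extends f by [point] outside D, and [point] is 0 in R. *)
Definition L2norm (R : realType) (f : R * R -> R) : \bar R :=
  ('N[lebesgue_measure \x lebesgue_measure]_2
     [EFin \o (f \_ (unit_square R))])%E.

Definition dist (R : realType) (w : R * R -> R) (S : set (R * R -> R)) : \bar R :=
  ereal_inf [set L2norm (w \- h) | h in S].

Section Superposition.
Context (R : realType) (J : nat).

Definition scaled (rho : R) (wt : 'I_J -> R * R -> R) : 'I_J -> R * R -> R :=
  fun j p => rho * wt j p.

Implicit Type w : 'I_J -> R * R -> R.

Definition superposition w : R * R -> R :=
  fun p => 1 - \prod_(j < J) (1 - w j p).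

Definition log_feature w (j : 'I_J) : R * R -> R := fun p => - ln (1 - w j p).

(* A parameter (gamma_0, gamma_1, ..., gamma_J) is a row vector g of length
   J.+1: gamma_0 is g 0 ord0, and the gamma attached to the component w j is
   g 0 (lift ord0 j). *)
Implicit Type g : 'rV[R]_J.+1.

Definition nonneg g : Prop := forall i, 0 <= g 0 i.

Definition gamma_star : 'rV[R]_J.+1 := \row_i (i != ord0)%:R.

Definition w_gamma w g : R * R -> R := fun p =>
  1 - expR (- g 0 ord0 - \sum_(j < J) g 0 (lift ord0 j) * log_feature w j p).

Definition noisy_or_class w : set (R * R -> R) :=
  [set w_gamma w g | g in nonneg].

Definition first_order w g : R * R -> R := fun p =>
  (1 - expR (- g 0 ord0))
  + expR (- g 0 ord0) * \sum_(j < J) g 0 (lift ord0 j) * w j p.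

Definition cone w : set (R * R -> R) :=
  [set k | exists (c : R) (a : 'I_J -> R), (forall j, 0 <= a j) /\
     k = (fun p => c + \sum_(j < J) a j * w j p)].

End Superposition.

Arguments gamma_star {R J}.

(* Main.v *)
Require Import Defs.
From HB Require Import structures.
From mathcomp Require Import all_boot all_order all_algebra.
From mathcomp Require Import all_classical all_reals all_analysis.
From mathcomp Require Import ring lra.
Import Order.TTheory GRing.Theory Num.Theory.
Import numFieldNormedType.Exports.
Local Open Scope classical_set_scope.
Local Open Scope ring_scope.

(** In the coordinates [x_j = - ln (1 - w_j)] the superposition is
    exponential-linear: [\prod_j (1 - w_j) = exp (- \sum_j x_j)].  Hence it is
    the member of the noisy-or class with [gamma_0 = 0] and every other
    [gamma_j = 1], as soon as [w_j < 1] so that the logarithms are genuine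
    ([superposition_w_gamma]); its distance to the class then vanishes because
    a function that is zero on the square has zero norm.

    For the expansion, fix a point and put [s = \sum_j gamma_j x_j] and
    [l = \sum_j gamma_j w_j].  The error of the first-order formula is exactly
    [exp (- gamma_0) * (1 - l - exp (- s))], and the prefactor is at most 1
    because [gamma_0 >= 0].
    Two second-order facts remain: [x_j] exceeds [w_j] by at most
    [2 * w_j ^+ 2] when [w_j <= 1 / 2] ([opp_ln1B_bounds]), which makes
    [s - l] of order [rho ^+ 2]; and [exp (- s)] differs from [1 - l] by at
    most [(s - l) + l ^+ 2] ([expRN_linear_error]), where [l] is of order
    [rho].  All constants depend only on [J] and a bound [M] for the entries
    of gamma, whence the uniformity.  The first-order formula is itself an
    element of the cone. *)

(** Both bounds come from the tangent inequality [1 + t <= expR t], at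
    [t = - x] and at [t = x], where [x = - ln (1 - v)]: the second one gives
    [1 + x <= (1 - v)^-1], and [(1 - v)^-1 <= 1 + v + 2 * v ^+ 2] holds
    up to [v = 1 / 2]. *)
Lemma opp_ln1B_bounds (R : realType) (v : R) :
  0 <= v <= 2^-1 -> v <= - ln (1 - v) <= v + 2 * v ^+ 2.
Proof.
move=> /andP[v0 v2]; have v1 : 0 < 1 - v by lra.
have E : expR (ln (1 - v)) = 1 - v by rewrite lnK.
have lo := expR_ge1Dx (ln (1 - v)); rewrite E in lo.
have hi := expR_ge1Dx (- ln (1 - v)); rewrite expRN E in hi.
have inv : (1 - v)^-1 <= 1 + v + 2 * v ^+ 2.
  rewrite -[leLHS]mul1r ler_pdivrMr //.
  have : 0 <= v ^+ 2 * (1 - 2 * v) by apply: mulr_ge0; [exact: sqr_ge0|lra].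
  lra.
apply/andP; split; lra.
Qed.

(** From below, [1 - s <= exp (- s)].  From above, monotonicity and the tangent
    inequality give [exp (- s) <= exp (- l) <= (1 + l)^-1], and
    [(1 + l)^-1 <= 1 - l + l ^+ 2]. *)
Lemma expRN_linear_error (R : realType) (l s e : R) :
  0 <= l -> l <= s <= l + e -> `|1 - l - expR (- s)| <= e + l ^+ 2.
Proof.
move=> l0 /andP[ls se].
have lo := expR_ge1Dx (- s).
have mono : expR (- s) <= expR (- l) by rewrite ler_expR lerN2.
have inv : expR (- l) <= 1 - l + l ^+ 2.
  rewrite expRN -[leLHS]mul1r ler_pdivrMr ?expR_gt0 //.
  have tan := expR_ge1Dx l.
  have pos : 0 < 1 - l + l ^+ 2 by nra.
  have : (1 - l + l ^+ 2) * (1 + l) <= (1 - l + l ^+ 2) * expR l.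
    by rewrite ler_pM2l.
  have : 0 <= l ^+ 3 by apply: exprn_ge0.
  lra.
have l2 : 0 <= l ^+ 2 by exact: sqr_ge0.
rewrite ler_norml; apply/andP; split; lra.
Qed.

Lemma entry_le_mx_norm (R : realType) (m n : nat) (g : 'M[R]_(m.+1, n.+1)) i j :
  `|g i j| <= `|g|.
Proof.
rewrite [leRHS]mx_normrE.
exact: (le_bigmax _ (fun ij : 'I_m.+1 * 'I_n.+1 => `|g ij.1 ij.2|) (i, j)).
Qed.

Lemma superposition_w_gamma (R : realType) (J : nat) (w : 'I_J -> R * R -> R) p :
  (forall j, w j p < 1) -> superposition w p = w_gamma w gamma_star p.
Proof.
move=> w1; rewrite /superposition /w_gamma /gamma_star; congr (1 - _).
rewrite mxE eqxx oppr0 add0r -sumrN expR_sum; apply: eq_bigr => j _.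
by rewrite mxE /= mul1r /log_feature opprK lnK // posrE subr_gt0.
Qed.

Lemma nonneg_gamma_star (R : realType) (J : nat) : nonneg (@gamma_star R J).
Proof. by move=> i; rewrite mxE ler0n. Qed.

Lemma L2norm_eq0 (R : realType) (f : R * R -> R) :
  (forall p, unit_square R p -> f p = 0) -> L2norm f = 0%E.
Proof.
move=> f0; rewrite /L2norm.
have -> : EFin \o (f \_ (unit_square R)) = cst 0%E.
  by apply/funext => p /=; rewrite patchE; case: ifPn => // /set_mem /f0 ->.
exact: Lnorm0.
Qed.

Lemma dist_eq0 (R : realType) (w h : R * R -> R) (S : set (R * R -> R)) :
  S h -> (forall p, unit_square R p -> w p = h p) -> dist w S = 0%E.
Proof.
move=> Sh wh; apply/eqP; rewrite eq_le; apply/andP; split.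
  apply: ereal_inf_lbound; exists h => //.
  by apply: L2norm_eq0 => p /wh /= ->; rewrite subrr.
by apply: le_ereal_inf_tmp => _ [k _ <-]; exact: Lnorm_ge0.
Qed.

Lemma scaled_bounds (R : realType) (J : nat) (rho : R) (wt : 'I_J -> R * R -> R) :
  0 <= rho -> (forall j, graphon (wt j)) ->
  forall j p, unit_square R p -> 0 <= scaled rho wt j p <= rho.
Proof.
move=> rho0 gr j p Dp; have [_ _ /(_ p Dp)/andP[a b]] := gr j.
by rewrite /scaled mulr_ge0 //= ler_piMr.
Qed.

Lemma first_order_cone (R : realType) (J : nat) (w : 'I_J -> R * R -> R)
    (g : 'rV[R]_J.+1) :
  nonneg g -> cone w (first_order w g).
Proof.
move=> g0; exists (1 - expR (- g 0 ord0)).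
exists (fun j => expR (- g 0 ord0) * g 0 (lift ord0 j)); split.
  by move=> j; rewrite mulr_ge0 ?expR_ge0.
apply/funext => p; rewrite /first_order mulr_sumr; congr (_ + _).
by apply: eq_bigr => j _; rewrite mulrA.
Qed.

(** The two parts of the constant are the bound [2 * J * M] for [s - l] and
    [(J * M) ^+ 2] for [l ^+ 2], both relative to [r ^+ 2]. *)
Lemma w_gamma_first_order (R : realType) (J : nat) (w : 'I_J -> R * R -> R)
    (g : 'rV[R]_J.+1) (p : R * R) (r M : R) :
  r <= 2^-1 -> (forall j, 0 <= w j p <= r) ->
  nonneg g -> (forall i, g 0 i <= M) ->
  `|w_gamma w g p - first_order w g p|
    <= (2 * J%:R * M + (J%:R * M) ^+ 2) * r ^+ 2.
Proof.
move=> r2 wr g0 gM; rewrite /w_gamma /first_order.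
set s := \sum_j _ * log_feature w j p; set l := \sum_j _ * w j p.
have M0 : 0 <= M by apply: le_trans (g0 ord0) (gM ord0).
have l0 : 0 <= l.
  by apply: sumr_ge0 => j _; have /andP[? _] := wr j; rewrite mulr_ge0.
have lM : l <= J%:R * M * r.
  have -> : J%:R * M * r = \sum_(j < J) M * r.
    by rewrite sumr_const card_ord -[RHS]mulr_natl mulrA.
  by apply: ler_sum => j _; have /andP[? ?] := wr j; rewrite ler_pM.
have x_bounds j : w j p <= log_feature w j p <= w j p + 2 * w j p ^+ 2.
  have /andP[a b] := wr j.
  by apply: opp_ln1B_bounds; rewrite a (le_trans b).
have ls : l <= s.
  by apply: ler_sum => j _; have /andP[? _] := x_bounds j; rewrite ler_wpM2l.
have sl : s <= l + 2 * J%:R * M * r ^+ 2.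
  have -> : 2 * J%:R * M * r ^+ 2 = \sum_(j < J) M * (2 * r ^+ 2).
    by rewrite sumr_const card_ord -[RHS]mulr_natl; ring.
  rewrite -big_split; apply: ler_sum => j _ /=.
  have /andP[a b] := wr j; have /andP[_ xj] := x_bounds j.
  apply: (le_trans (ler_wpM2l (g0 _) xj)).
  rewrite mulrDr lerD2l; apply: ler_pM => //.
    by rewrite mulr_ge0 // sqr_ge0.
  by rewrite ler_pM2l // lerXn2r ?nnegrE // (le_trans a).
have -> : 1 - expR (- g 0 ord0 - s)
    - (1 - expR (- g 0 ord0) + expR (- g 0 ord0) * l)
    = expR (- g 0 ord0) * (1 - l - expR (- s)).
  by rewrite expRD; ring.
rewrite normrM ger0_norm ?expR_ge0 //.
have e1 : expR (- g 0 ord0) <= 1 by rewrite -expR0 ler_expR oppr_le0.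
apply: (le_trans (ler_piMl (normr_ge0 _) e1)).
apply: (le_trans (expRN_linear_error R l s (2 * J%:R * M * r ^+ 2) l0 _)).
  by rewrite ls sl.
rewrite [leRHS]mulrDl lerD2l -exprMn lerXn2r ?nnegrE //.
exact: le_trans lM.
Qed.

Theorem theorem1 (R : realType) (J : nat) :
  (forall (rho : R) (wt : 'I_J -> R * R -> R),
     0 < rho < 1 -> (forall j, graphon (wt j)) ->
     let w := scaled rho wt in
     (forall p, unit_square R p -> superposition w p = w_gamma w gamma_star p)
     /\ dist (superposition w) (noisy_or_class w) = 0%E)
  /\
  (forall G : set 'rV[R]_J.+1, bounded_set G -> (forall g, G g -> nonneg g) ->
     exists C : R, \forall rho \near 0^'+,
       forall wt : 'I_J -> R * R -> R, (forall j, graphon (wt j)) ->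
       let w := scaled rho wt in
       forall g, G g ->
         (forall p, unit_square R p ->
            `|w_gamma w g p - first_order w g p| <= C * rho ^+ 2)
         /\ (exists2 k, cone w k & forall p, unit_square R p ->
               `|w_gamma w g p - k p| <= C * rho ^+ 2)).
Proof.
split.
  move=> rho wt /andP[rho0 rho1] gr w.
  have eq p : unit_square R p -> superposition w p = w_gamma w gamma_star p.
    move=> Dp; apply: superposition_w_gamma => j.
    have /andP[_ b] := scaled_bounds _ _ _ _ (ltW rho0) gr j p Dp.
    exact: le_lt_trans rho1.
  split=> //; apply: (dist_eq0 _ _ _ _ _ eq).
  by exists gamma_star => //; exact: nonneg_gamma_star.
move=> G [M0 [_ GM]] Gnn.
(* Boundedness only gives [`|g| <= M] for [M] strictly above [M0]. *)
pose M := M0 + 1.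
have gM g i : G g -> g 0 i <= M.
  move=> Gg; have gle : `|g| <= M by apply: GM => //; rewrite /M ltrDl.
  exact: le_trans (ler_norm _) (le_trans (entry_le_mx_norm _ _ _ _ _ _) gle).
exists (2 * J%:R * M + (J%:R * M) ^+ 2).
have half : (0 : R) < 2^-1 by rewrite invr_gt0.
near=> rho => wt gr g Gg.
have rho0 : 0 <= rho by apply: ltW; near: rho; exact: nbhs_right_gt.
have rho2 : rho <= 2^-1 by near: rho; exact: nbhs_right_ltW.
set w := scaled rho wt.
have err p : unit_square R p -> `|w_gamma w g p - first_order w g p|
    <= (2 * J%:R * M + (J%:R * M) ^+ 2) * rho ^+ 2.
  move=> Dp; apply: w_gamma_first_order => //.
  - by move=> j; exact: scaled_bounds.
  - exact: Gnn.
  - by move=> i; exact: gM.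
split=> //; exists (first_order w g) => //.
by apply: first_order_cone; exact: Gnn.
Unshelve. all: by end_near.
Qed.
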